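(* Let $f(X)=a_{0}+a_{1}X+\cdots +a_{n}X^{n}\in \mathbb{Z}[X]$, $a_{0}a_{n}\neq 0$, let $k\geq 2$ and let $p_{1},\dots ,p_{k}$ be pairwise distinct prime numbers. Assume that there exist indices $j_{1},\dots ,j_{k}\in \{1,\dots ,n-1\}$ such that for each $i=1,\dots ,k$ we have either (i) $\nu _{p_{i}}(a_{0}) = 0$; $\frac{\nu _{p_{i}}(a_{l})}{l} > \frac{\nu _{p_{i}}(a_{j_{i}})}{j_{i}}$ for $0<l<j_{i}$; $\nu _{p_{i}}(a_{j_{i}})>0$; $\nu _{p_{i}}(a_{l}) > \frac{n-l}{n-j_{i}}\, \nu _{p_{i}}(a_{j_{i}})+\frac{l-j_{i}}{n-j_{i}}\, \nu _{p_{i}}(a_{n})$ for $j_{i}<l<n$; and $\frac{\nu _{p_{i}}(a_{n})}{n}>\frac{\nu _{p_{i}}(a_{j_{i}})}{j_{i}}$; or (ii) $\frac{\nu _{p_{i}}(a_{0})}{n}>\frac{\nu _{p_{i}}(a_{j_{i}})}{n-j_{i}}$; $\nu _{p_{i}}(a_{l}) > \frac{j_{i}-l}{j_{i}}\, \nu _{p_{i}}(a_{0})+\frac{l}{j_{i}}\, \nu _{p_{i}}(a_{j_{i}})$ for $0<l<j_{i}$; $\nu _{p_{i}}(a_{j_{i}})>0$; $\frac{\nu _{p_{i}}(a_{l})}{n-l} > \frac{\nu _{p_{i}}(a_{j_{i}})}{n-j_{i}}$ for $j_{i}<l<n$; and $\nu _{p_{i}}(a_{n}) = 0$. For $i=1,\dots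 ,k$ let \[ d_{p_{i}}=\gcd \left( \frac{j_{i}}{\gcd (\nu _{p_{i}}(a_{j_{i}})-\nu _{p_{i}}(a_{0}),\,j_{i})},\ \frac{n-j_{i}}{\gcd (\nu _{p_{i}}(a_{n})-\nu _{p_{i}}(a_{j_{i}}),\,n-j_{i})} \right). \] If $\gcd\left(\frac{n}{d_{p_{1}}},\dots ,\frac{n}{d_{p_{k}}}\right)=1$, then $f$ is irreducible over $\mathbb{Q}$.
   Context: For a prime $p$ and a nonzero integer $m$, $\nu_p(m)$ is the largest integer $i$ such that $p^i\mid m$; by convention $\nu_p(0)=\infty$ (so lower bounds on $\nu_p(a_l)$ hold automatically when $a_l=0$). *)

(* Defs.v *)
From mathcomp Require Import all_boot all_order all_algebra.
From mathcomp Require Import constructive_ereal.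

Set Implicit Arguments.
Unset Strict Implicit.
Unset Printing Implicit Defensive.

Import Order.TTheory GRing.Theory Num.Theory.

Local Open Scope ring_scope.

(* The p-adic valuation of an integer, for p prime and m != 0; the junk value
   at m = 0 is 0, see [nu] for the version with value +oo there. *)
Definition vp (p : nat) (m : int) : nat := logn p `|m|%N.

(* Valued in the extended rationals, so that the slope inequalities below can
   be written with the convention nu p 0 = +oo. *)
Definition nu (p : nat) (m : int) : \bar rat :=
  if m == 0 then +oo%E else ((vp p m)%:R)%:E.

(* All natural-number subtractions below are exact since 0 < j < n and l lies
   in the stated ranges; all scalars are then positive, so the library's
   convention 0 * +oo = 0 plays no role. The last inequality of [case_i] (resp.
   the first of [case_ii]) forces a_j != 0 when a_n != 0 (resp. a_0 != 0). *)
Definition case_i (f : {poly int}) (n p j : nat) : Prop :=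
  [/\ nu p f`_0 = 0%E,
      forall l : nat, (0 < l < j)%N ->
        (nu p f`_l * (l%:R^-1)%:E > nu p f`_j * (j%:R^-1)%:E)%E,
      (nu p f`_j > 0)%E,
      forall l : nat, (j < l < n)%N ->
        (nu p f`_l > ((n - l)%N%:R / (n - j)%N%:R)%:E * nu p f`_j
                   + ((l - j)%N%:R / (n - j)%N%:R)%:E * nu p f`_n)%E
    & (nu p f`_n * (n%:R^-1)%:E > nu p f`_j * (j%:R^-1)%:E)%E].

Definition case_ii (f : {poly int}) (n p j : nat) : Prop :=
  [/\ (nu p f`_0 * (n%:R^-1)%:E > nu p f`_j * ((n - j)%N%:R^-1)%:E)%E,
      forall l : nat, (0 < l < j)%N ->
        (nu p f`_l > ((j - l)%N%:R / j%:R)%:E * nu p f`_0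
                   + (l%:R / j%:R)%:E * nu p f`_j)%E,
      (nu p f`_j > 0)%E,
      forall l : nat, (j < l < n)%N ->
        (nu p f`_l * ((n - l)%N%:R^-1)%:E
           > nu p f`_j * ((n - j)%N%:R^-1)%:E)%E
    & nu p f`_n = 0%E].

(* [`|(x%:Z - y%:Z)%R|%N] is the absolute value of the integer difference; the
   sign is irrelevant inside a gcd. *)
Definition dp (f : {poly int}) (n p j : nat) : nat :=
  gcdn
    (j %/ gcdn `|((vp p f`_j)%:Z - (vp p f`_0)%:Z)%R| j)
    ((n - j) %/ gcdn `|((vp p f`_n)%:Z - (vp p f`_j)%:Z)%R| (n - j)).

(* Main.v *)
Require Import Defs.
From mathcomp Require Import all_boot all_order all_algebra.
From mathcomp Require Import constructive_ereal.
From mathcomp Require Import zify ring.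

(** For a prime p and a slope, give the coefficient of X^l the weight
    A * nu_p(a_l) + B * l.  By the Gauss lemma argument, the minimal weight of a
    product g * h is the sum of the minimal weights of g and h.  Each hypothesis
    says that the Newton polygon of f at p is made of the two edges
    (0, v_0)-(j, v_j)-(n, v_n), so that for the slope of the first (second) edge
    the minimal weight of f is attained at 0 and j (at j and n).  If f = g * h,
    some pair (a, b) with a + b = j satisfies v(g_a) + v(h_b) <= v(f_j), and then
    g attains its minimal weight at 0 and a for the first slope, and at a and
    deg g for the second.  Equality of these weights makes the reduced
    denominators of the two slopes divide a and deg g - a, whence d_p divides
    deg g.  When the n / d_p are globally coprime, this forces n to divide
    deg g. *)

Set Implicit Arguments.
Unset Strict Implicit.

Import Order.TTheory GRing.Theory Num.Theory.

Local Open Scope ring_scope.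

(** * Ultrametric behaviour of the p-adic valuation *)

Lemma dvdz_vp (p e : nat) (x : int) : prime p -> x != 0 ->
  ((p ^ e)%N%:Z %| x)%Z = (e <= vp p x)%N.
Proof.
by move=> pp x0; rewrite dvdzE /= /vp pfactor_dvdn // lt0n absz_eq0.
Qed.

Lemma vpM (p : nat) (x y : int) : x != 0 -> y != 0 ->
  vp p (x * y) = (vp p x + vp p y)%N.
Proof. by move=> x0 y0; rewrite /vp abszM lognM // lt0n absz_eq0. Qed.

(** Otherwise a power of [p] one higher than the sum allows would divide every term. *)
Lemma vp_sum_le (p : nat) (I : finType) (F : I -> int) : prime p ->
  \sum_i F i != 0 ->
  exists i, F i != 0 /\ (vp p (F i) <= vp p (\sum_i F i))%N.
Proof.
move=> pp S0; case: (boolP [exists i, (F i != 0) && (vp p (F i) <= vp p (\sum_i F i))%N]).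
  by case/existsP => i /andP[]; exists i.
rewrite negb_exists => /forallP nF; exfalso.
have: ((p ^ (vp p (\sum_i F i)).+1)%N%:Z %| \sum_i F i)%Z.
  apply: rpred_sum => i _; have := nF i; rewrite negb_and negbK.
  have [-> _|Fi0 /=] := eqVneq (F i) 0; first exact: dvdz0.
  by rewrite -ltnNge -dvdz_vp.
by rewrite dvdz_vp // ltnn.
Qed.

Lemma vp_sum_dominant (p : nat) (I : finType) (F : I -> int) (i0 : I) :
  prime p -> F i0 != 0 ->
  (forall i, i != i0 -> F i != 0 -> (vp p (F i0) < vp p (F i))%N) ->
  \sum_i F i != 0 /\ vp p (\sum_i F i) = vp p (F i0).
Proof.
move=> pp F0 ltF; rewrite (bigD1 i0) //=; set S := \sum_(i | _) F i.
set v := vp p (F i0).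
have dS : ((p ^ v.+1)%N%:Z %| S)%Z.
  apply: rpred_sum => i /ltF.
  have [-> _|Fi0 /(_ isT)] := eqVneq (F i) 0; first exact: dvdz0.
  by rewrite -dvdz_vp.
have nd : ~~ ((p ^ v.+1)%N%:Z %| F i0 + S)%Z.
  by rewrite (rpredDr _ dS) dvdz_vp // ltnn.
have S0 : F i0 + S != 0 by apply: contraNneq nd => ->; rewrite dvdz0.
split=> //; apply/eqP; rewrite eqn_leq; apply/andP; split.
  by rewrite leqNgt -dvdz_vp.
have dS' : ((p ^ v)%N%:Z %| S)%Z.
  by apply: (@dvdz_trans (p ^ v.+1)%N%:Z); rewrite ?dvdzE /= ?dvdn_exp2l.
by rewrite -dvdz_vp // (rpredDr _ dS') dvdz_vp.
Qed.

(** * Weights and the Gauss lemma argument *)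

(** For [A > 0] this is [A] times the intercept of the line of slope [- B / A] through the Newton
    point at [l]; clearing the denominator keeps it in [int]. It is meaningful only at nonzero
    coefficients, since [vp p 0] is 0. *)
Definition weight (A : nat) (B : int) (p : nat) (g : {poly int}) (l : nat) : int :=
  A%:Z * (vp p g`_l)%:Z + B * l%:Z.

Section Weight.

Variables (A : nat) (B : int) (p : nat).
Hypothesis pp : prime p.

Local Notation wt := (weight A B p).

(** Taking the least index among the minimizers yields the strict inequality that isolates a single
    dominant term in a product. *)
Lemma first_min_weight (g : {poly int}) : g != 0 ->
  exists s, [/\ g`_s != 0, forall l, g`_l != 0 -> wt g s <= wt g l
    & forall l, (l < s)%N -> g`_l != 0 -> wt g s < wt g l].
Proof.
move=> g0; have ltg : ((size g).-1 < size g)%N by rewrite prednK ?lt0n ?size_poly_eq0.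
have lead0 : g`_(Ordinal ltg) != 0 by rewrite -/(lead_coef g) lead_coef_eq0.
have [m gm minm] := arg_minP (P := fun i : 'I_(size g) => g`_i != 0) (fun i => wt g i) lead0.
have minm' l : g`_l != 0 -> wt g m <= wt g l.
  move=> gl; have [lt|ge] := ltnP l (size g); first exact: (minm (Ordinal lt)).
  by rewrite nth_default ?eqxx in gl.
have exs : exists s, (g`_s != 0) && (wt g s <= wt g m) by exists m; rewrite gm lexx.
case: (ex_minnP exs) => s /andP[gs les] mins; exists s; split=> // [l gl|l lts gl].
  exact: le_trans les (minm' l gl).
rewrite ltNge; apply/negP => le; have := mins l; rewrite gl (le_trans le les).
by move=> /(_ isT); rewrite leqNgt lts.
Qed.

(** If [s] and [t] are the first minimizers for [g] and [h], the coefficient of the product at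
    [s + t] has one dominant term, so its weight is the sum of the two minima. *)
Lemma min_weightM (g h : {poly int}) (M : int) :
  (forall l, (g * h)`_l != 0 -> M <= wt (g * h) l) ->
  forall a b, g`_a != 0 -> h`_b != 0 -> M <= wt g a + wt h b.
Proof.
move=> leM a b ga hb.
have g0 : g != 0 by apply: contraNneq ga => ->; rewrite coef0.
have h0 : h != 0 by apply: contraNneq hb => ->; rewrite coef0.
have [s [gs mins lts]] := first_min_weight g0.
have [t [ht mint ltt]] := first_min_weight h0.
have Os : (s < (s + t).+1)%N by rewrite ltnS leq_addr.
have := @vp_sum_dominant p _ (fun i : 'I_(s + t).+1 => g`_i * h`_(s + t - i))
   (Ordinal Os) pp.
rewrite /= addKn mulf_neq0 // => /(_ isT) []; last first.
  rewrite -coefM => n0 vE; apply: (le_trans (leM _ n0)).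
  apply: (@le_trans _ _ (wt g s + wt h t)); last by apply: lerD; [exact: mins|exact: mint].
  by rewrite /weight vE vpM // !PoszD; move: (vp p g`_s) (vp p h`_t); lia.
move=> i ne; rewrite mulf_eq0 negb_or => /andP[gi hi]; rewrite !vpM //.
have lti := ltn_ord i; have {ne} : (i : nat) <> s by move=> Ei; case/eqP: ne; apply: val_inj.
have := mins _ gi; have := mint _ hi.
have := lts i ^~ gi; have := ltt (s + t - i)%N ^~ hi; rewrite /weight.
move: (vp p g`_i) (vp p h`_(s + t - i)) (vp p g`_s) (vp p h`_t) => x y z w.
move=> h1 h2 h3 h4 ne.
(* All terms have index sum [s + t], so the [B] parts cancel; any other term has its first index
   below [s] or its second below [t]. *)
have : A%:Z * (z%:Z + w%:Z) < A%:Z * (x%:Z + y%:Z).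
  have E : (s + t - i)%N%:Z = s%:Z + t%:Z - i%:Z by lia.
  have [lt|ge] := ltnP i s; first by have := h2 lt; rewrite E in h3 *; lia.
  have lt : (s + t - i < t)%N by lia.
  by have := h1 lt; rewrite E; lia.
by nia.
Qed.

(** Compare with the crossed pairs [(a, b')] and [(a', b)], whose weights are at least [M]. *)
Lemma min_weight_eq (g h : {poly int}) (M : int) (a b a' b' : nat) :
  (forall l, (g * h)`_l != 0 -> M <= wt (g * h) l) ->
  g`_a != 0 -> h`_b != 0 -> g`_a' != 0 -> h`_b' != 0 ->
  wt g a + wt h b <= M -> wt g a' + wt h b' <= M -> wt g a = wt g a'.
Proof.
move=> leM ga hb ga' hb' le1 le2.
have := min_weightM leM ga hb'; have := min_weightM leM ga' hb; lia.
Qed.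

End Weight.

(** * From the two edges to the degree of a factor *)

(** The quotient is the denominator of [u / j] in lowest terms, hence coprime to the reduced
    numerator. *)
Lemma dvdn_divgcd (j a : nat) (u : int) : (0 < j)%N ->
  (j%:Z %| u * a%:Z)%Z -> (j %/ gcdn `|u| j %| a)%N.
Proof.
move=> j0; rewrite dvdzE abszM /= => d.
have g0 : (0 < gcdn `|u| j)%N by rewrite gcdn_gt0 j0 orbT.
have [gu gj] := (dvdn_gcdl `|u| j, dvdn_gcdr `|u| j).
have cop : coprime (j %/ gcdn `|u| j) (`|u| %/ gcdn `|u| j).
  by rewrite /coprime -(eqn_pmul2r g0) muln_gcdl !divnK // mul1n gcdnC.
by rewrite -(Gauss_dvdr _ cop) -(dvdn_pmul2r g0) mulnAC !divnK.
Qed.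

(** Reduces an inequality to a known one through an identity left to [ring]. *)
Lemma ler_of_subr (R : numDomainType) (a b c d : R) :
  d - c = b - a -> c <= d -> a <= b.
Proof. by move=> E; rewrite -(subr_ge0 c) E subr_ge0. Qed.

(* With a = j, b = l - j, c = n - l: if the point w at l lies above the edge
   from (j, y) to (n, z), and the slope of that edge is at least the
   slope of the edge from (0, x) to (j, y), then w lies above the prolongation of
   the latter. *)
Lemma above_prolongation (a b c x y z w : int) : 0 <= a -> 0 <= b -> 0 < b + c ->
  c * y + b * z <= (b + c) * w ->
  (a + b + c) * y <= a * z + (b + c) * x ->
  a * x <= a * w + (x - y) * (a + b).
Proof.
move=> a0 b0 bc H1 H2; rewrite -(ler_pM2l bc) -subr_ge0.
(* Scaled by [b + c], the difference combines the slacks of [H1] and [H2] with coefficients [a] and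
   [b]. *)
have -> : (b + c) * (a * w + (x - y) * (a + b)) - (b + c) * (a * x) =
  a * ((b + c) * w - (c * y + b * z)) + b * (a * z + (b + c) * x - (a + b + c) * y).
  by ring.
by rewrite addr_ge0 // mulr_ge0 // subr_ge0.
Qed.

Lemma dp_dvd_deg (g h : {poly int}) (n p j : nat) (v := fun l => vp p (g * h)`_l) :
  prime p -> size (g * h) = n.+1 -> (0 < j < n)%N ->
  (g * h)`_0 != 0 -> (g * h)`_j != 0 ->
  (forall l, (0 < l < j)%N -> (g * h)`_l != 0 ->
     ((j - l) * v 0 + l * v j <= j * v l)%N) ->
  (forall l, (j < l < n)%N -> (g * h)`_l != 0 ->
     ((n - l) * v j + (l - j) * v n <= (n - j) * v l)%N) ->
  (n * v j <= j * v n + (n - j) * v 0)%N ->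
  (dp (g * h) n p j %| (size g).-1)%N.
Proof.
move=> pp szf /andP[j0 jn] f0 fj le1 le2 conv.
have fz : g * h != 0 by rewrite -size_poly_eq0 szf.
have /norP[g0 h0] : ~~ ((g == 0) || (h == 0)) by rewrite -mulf_eq0.
have fn : (g * h)`_n != 0 by have := fz; rewrite -lead_coef_eq0 /lead_coef szf.
have fle l : (g * h)`_l != 0 -> (l <= n)%N.
  by move=> fl; rewrite -ltnS -szf ltnNge; apply: contra fl => /(nth_default 0) ->.
have E0 : (g * h)`_0 = g`_0 * h`_0 by rewrite coefM big_ord1.
have En : (g * h)`_n = lead_coef g * lead_coef h by rewrite -lead_coefM /lead_coef szf.
have /norP[g00 h00] : ~~ ((g`_0 == 0) || (h`_0 == 0)) by rewrite -mulf_eq0 -E0.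
have gl : lead_coef g != 0 by rewrite lead_coef_eq0.
have hl : lead_coef h != 0 by rewrite lead_coef_eq0.
have szn : ((size g).-1 + (size h).-1)%N = n.
  move: szf; rewrite size_mul //; move: g0 h0; rewrite -!size_poly_eq0.
  by move: (size g) (size h) => x y; lia.
have [a [fa lea]] : exists i : 'I_j.+1, g`_i * h`_(j - i) != 0 /\
    (vp p (g`_i * h`_(j - i)) <= v j)%N.
  by rewrite /v coefM; apply: vp_sum_le; rewrite // -coefM.
have /norP[ga ha] : ~~ ((g`_a == 0) || (h`_(j - a) == 0)) by rewrite -mulf_eq0.
have aj : (a <= j)%N by rewrite -ltnS.
rewrite vpM // in lea.
have v0 : v 0%N = (vp p g`_0 + vp p h`_0)%N by rewrite /v E0 vpM.
have vn : v n = (vp p g`_(size g).-1 + vp p h`_(size h).-1)%N by rewrite /v En vpM.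
have vE l : vp p (g * h)`_l = v l by [].
clearbody v; rewrite /dp !vE.
(* With factor [j], [B1] gives the weight [j * v 0] at both 0 and [j]; with factor [n - j], [B2]
   gives [n * v j - j * v n] at both [j] and [n]. *)
pose B1 := (v 0%N)%:Z - (v j)%:Z; pose B2 := (v j)%:Z - (v n)%:Z.
(* The edge inequalities pass to [int] and to the end points, where they are equalities. *)
have le1Z l : (l <= j)%N -> (g * h)`_l != 0 ->
    (j%:Z - l%:Z) * (v 0%N)%:Z + l%:Z * (v j)%:Z <= j%:Z * (v l)%:Z.
  rewrite leq_eqVlt => /predU1P[->|lj] fl; first by rewrite subrr mul0r add0r.
  have [->|l0] := posnP l; first by move: (v 0%N) (v j) => x y; lia.
  by have := le1 l; rewrite l0 lj fl subzn ?(ltnW lj) // -!PoszM -PoszD lez_nat; apply.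
have le2Z l : (j <= l)%N -> (g * h)`_l != 0 ->
    (n%:Z - l%:Z) * (v j)%:Z + (l%:Z - j%:Z) * (v n)%:Z <= (n%:Z - j%:Z) * (v l)%:Z.
  rewrite leq_eqVlt => /predU1P[<- fl|jl fl]; first by rewrite subrr mul0r addr0.
  have := fle l fl; rewrite leq_eqVlt => /predU1P[->|ln].
    by rewrite subrr mul0r add0r.
  have := le2 l; rewrite jl ln fl !subzn ?(ltnW jl) ?(ltnW ln) ?(ltnW jn) //.
  by rewrite -!PoszM -PoszD lez_nat; apply.
have convZ : n%:Z * (v j)%:Z <= j%:Z * (v n)%:Z + (n%:Z - j%:Z) * (v 0%N)%:Z.
  by rewrite subzn ?(ltnW jn) // -!PoszM -PoszD lez_nat.
have jnZ : j%:Z < n%:Z by rewrite ltz_nat.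
have all1 l : (g * h)`_l != 0 -> j%:Z * (v 0%N)%:Z <= weight j B1 p (g * h) l.
  move=> fl; rewrite /weight vE /B1.
  have [lj|jl] := leqP l j; first by apply: ler_of_subr (le1Z l lj fl); ring.
  have jlZ : j%:Z < l%:Z by rewrite ltz_nat.
  have H1 : 0 < l%:Z - j%:Z + (n%:Z - l%:Z) by rewrite addrC subrKA subr_gt0.
  have H2 : (n%:Z - l%:Z) * (v j)%:Z + (l%:Z - j%:Z) * (v n)%:Z
      <= (l%:Z - j%:Z + (n%:Z - l%:Z)) * (v l)%:Z.
    by apply: ler_of_subr (le2Z l (ltnW jl) fl); ring.
  have H3 : (j%:Z + (l%:Z - j%:Z) + (n%:Z - l%:Z)) * (v j)%:Z
      <= j%:Z * (v n)%:Z + (l%:Z - j%:Z + (n%:Z - l%:Z)) * (v 0%N)%:Z.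
    by apply: ler_of_subr convZ; ring.
  apply: ler_of_subr (above_prolongation _ _ H1 H2 H3) => //; first ring.
  by rewrite subr_ge0 ltW.
have all2 l : (g * h)`_l != 0 ->
    n%:Z * (v j)%:Z - j%:Z * (v n)%:Z <= weight (n - j) B2 p (g * h) l.
  move=> fl; rewrite /weight vE /B2 -subzn ?(ltnW jn) //.
  have [jl|lj] := leqP j l; first by apply: ler_of_subr (le2Z l jl fl); ring.
  (* Mirror image of the previous use of [above_prolongation]: indices are reflected by [l] to
     [n - l]. *)
  have jlZ : l%:Z < j%:Z by rewrite ltz_nat.
  have H1 : 0 < j%:Z - l%:Z + l%:Z by rewrite subrK ltz_nat.
  have H2 : l%:Z * (v j)%:Z + (j%:Z - l%:Z) * (v 0%N)%:Z
      <= (j%:Z - l%:Z + l%:Z) * (v l)%:Z.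
    by apply: ler_of_subr (le1Z l (ltnW lj) fl); ring.
  have H3 : (n%:Z - j%:Z + (j%:Z - l%:Z) + l%:Z) * (v j)%:Z
      <= (n%:Z - j%:Z) * (v 0%N)%:Z + (j%:Z - l%:Z + l%:Z) * (v n)%:Z.
    by apply: ler_of_subr convZ; ring.
  apply: ler_of_subr (above_prolongation _ _ H1 H2 H3); first ring.
    by rewrite subr_ge0 ltW.
  by rewrite subr_ge0 ltW.
have leaZ : (vp p g`_a)%:Z + (vp p h`_(j - a))%:Z <= (v j)%:Z by rewrite -PoszD lez_nat.
have eq1 : weight j B1 p g 0 = weight j B1 p g a.
  apply: (min_weight_eq pp all1 g00 h00 ga ha); rewrite /weight /B1.
    by rewrite !mulr0 !addr0 -mulrDr v0 PoszD.
  by rewrite -subzn //; apply: ler_of_subr (ler_wpM2l (le0z_nat j) leaZ); ring.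
have eq2 : weight (n - j) B2 p g (size g).-1 = weight (n - j) B2 p g a.
  apply: (min_weight_eq pp all2 gl hl ga ha); rewrite /weight /B2 -subzn ?(ltnW jn) //.
    by rewrite le_eqVlt; apply/orP; left; rewrite vn -szn !PoszD; apply/eqP; ring.
  rewrite -subzn //; have njZ : 0 <= n%:Z - j%:Z by rewrite subr_ge0 ltW.
  by apply: ler_of_subr (ler_wpM2l njZ leaZ); ring.
have d1 : (j %/ gcdn `|((v j)%:Z - (v 0%N)%:Z)%R| j %| a)%N.
  apply: dvdn_divgcd => //; apply/dvdzP.
  (* [eq1] says that [(v j - v 0) * a] is [j] times this difference. *)
  exists ((vp p g`_a)%:Z - (vp p g`_0)%:Z).
  move: eq1; rewrite /weight /B1 mulr0 addr0 => E.
  by rewrite [RHS]mulrBl [(vp p g`_0)%:Z * _]mulrC E; ring.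
have agt : (a <= (size g).-1)%N.
  rewrite leqNgt; apply: contra ga => lt; rewrite nth_default //.
  exact: leq_trans (leqSpred _) lt.
have d2 : ((n - j) %/ gcdn `|((v n)%:Z - (v j)%:Z)%R| (n - j) %| (size g).-1 - a)%N.
  apply: dvdn_divgcd; first by rewrite subn_gt0.
  apply/dvdzP; exists ((vp p g`_(size g).-1)%:Z - (vp p g`_a)%:Z).
  move/eqP: eq2; rewrite /weight /B2 -subr_eq0 => /eqP E.
  apply/esym/eqP; rewrite -subr_eq0 -(subzn agt) -[X in _ == X]E.
  by apply/eqP; ring.
rewrite -(subnKC agt); apply: dvdn_add.
  exact: dvdn_trans (dvdn_gcdl _ _) d1.
exact: dvdn_trans (dvdn_gcdr _ _) d2.
Qed.

(** * Both cases in a common integral form *)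

(** Since [v 0 = 0], the slope inequalities below [j] and at [n] become, after clearing
    denominators, the chord inequality on the first edge and convexity at [j]. *)
Lemma case_iP (f : {poly int}) (n p j : nat) (v := fun l => vp p f`_l) :
  (0 < j < n)%N -> f`_0 != 0 -> f`_n != 0 -> case_i f n p j ->
  [/\ f`_j != 0,
      forall l, (0 < l < j)%N -> f`_l != 0 ->
        ((j - l) * v 0 + l * v j <= j * v l)%N,
      forall l, (j < l < n)%N -> f`_l != 0 ->
        ((n - l) * v j + (l - j) * v n <= (n - j) * v l)%N
    & (n * v j <= j * v n + (n - j) * v 0)%N].
Proof.
move=> /andP[j0 jn] f0 fn [n0 h1 _ h2 h3].
have jR : (0 : rat) < j%:R by rewrite ltr0n.
have nR : (0 : rat) < n%:R by rewrite ltr0n; lia.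
have njR : (0 : rat) < (n - j)%N%:R by rewrite ltr0n; lia.
have fj : f`_j != 0.
  apply/eqP => fj; move: h3; rewrite /nu fj eqxx gt0_mulye ?lte_fin ?invr_gt0 //.
  by rewrite (negPf fn) -EFinM ltNge leey.
have v0 : v 0%N = 0%N.
  by move: n0; rewrite /nu (negPf f0) => -[] /eqP; rewrite pnatr_eq0 => /eqP.
split=> // [l /[dup] /andP[l0 lj] /h1 + fl|l /[dup] /andP[jl ln] /h2 + fl|].
- rewrite /nu (negPf fj) (negPf fl) -!EFinM lte_fin.
  rewrite ltr_pdivrMr // mulrAC ltr_pdivlMr ?ltr0n // -!natrM ltr_nat -/(v l) -/(v j); lia.
- rewrite /nu (negPf fj) (negPf fl) (negPf fn) -!EFinM -EFinD lte_fin.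
  rewrite mulrAC [X in _ + X]mulrAC -mulrDl ltr_pdivrMr // -!natrM -natrD ltr_nat.
  rewrite -/(v l) -/(v j) -/(v n); lia.
- move: h3; rewrite /nu (negPf fj) (negPf fn) -!EFinM lte_fin.
  rewrite ltr_pdivrMr // mulrAC ltr_pdivlMr // -!natrM ltr_nat -/(v n) -/(v j); lia.
Qed.

(** The reversal of case (i): now [v n = 0], and the two edges exchange roles. *)
Lemma case_iiP (f : {poly int}) (n p j : nat) (v := fun l => vp p f`_l) :
  (0 < j < n)%N -> f`_0 != 0 -> f`_n != 0 -> case_ii f n p j ->
  [/\ f`_j != 0,
      forall l, (0 < l < j)%N -> f`_l != 0 ->
        ((j - l) * v 0 + l * v j <= j * v l)%N,
      forall l, (j < l < n)%N -> f`_l != 0 ->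
        ((n - l) * v j + (l - j) * v n <= (n - j) * v l)%N
    & (n * v j <= j * v n + (n - j) * v 0)%N].
Proof.
move=> /andP[j0 jn] f0 fn [h3 h1 _ h2 n0].
have jR : (0 : rat) < j%:R by rewrite ltr0n.
have nR : (0 : rat) < n%:R by rewrite ltr0n; lia.
have njR : (0 : rat) < (n - j)%N%:R by rewrite ltr0n; lia.
have fj : f`_j != 0.
  apply/eqP => fj; move: h3; rewrite /nu fj eqxx gt0_mulye ?lte_fin ?invr_gt0 //.
  by rewrite (negPf f0) -EFinM ltNge leey.
have vn : v n = 0%N.
  by move: n0; rewrite /nu (negPf fn) => -[] /eqP; rewrite pnatr_eq0 => /eqP.
split=> // [l /[dup] /andP[l0 lj] /h1 + fl|l /[dup] /andP[jl ln] /h2 + fl|].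
- rewrite /nu (negPf fj) (negPf fl) (negPf f0) -!EFinM -EFinD lte_fin.
  rewrite mulrAC [X in _ + X]mulrAC -mulrDl ltr_pdivrMr // -!natrM -natrD ltr_nat.
  rewrite -/(v l) -/(v j) -/(v 0%N); lia.
- have nlR : (0 : rat) < (n - l)%N%:R by rewrite ltr0n; lia.
  rewrite /nu (negPf fj) (negPf fl) -!EFinM lte_fin.
  rewrite ltr_pdivrMr // mulrAC ltr_pdivlMr // -!natrM ltr_nat -/(v l) -/(v j); lia.
- move: h3; rewrite /nu (negPf fj) (negPf f0) -!EFinM lte_fin.
  rewrite ltr_pdivrMr // mulrAC ltr_pdivlMr // -!natrM ltr_nat -/(v 0%N) -/(v j); lia.
Qed.

(** * Combining the primes *)

(** The two reduced denominators divide [j] and [n - j]. This makes the quotients of [n] in the gcd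
    condition exact. *)
Lemma dp_dvd (f : {poly int}) (n p j : nat) : (j <= n)%N -> (dp f n p j %| n)%N.
Proof.
have div_dvd d m : (d %| m)%N -> (m %/ d %| m)%N.
  by move=> dm; rewrite -{2}(divnK dm) dvdn_mulr.
move=> jn; rewrite -{2}(subnKC jn); apply: dvdn_add.
  exact: dvdn_trans (dvdn_gcdl _ _) (div_dvd _ _ (dvdn_gcdr _ _)).
exact: dvdn_trans (dvdn_gcdr _ _) (div_dvd _ _ (dvdn_gcdr _ _)).
Qed.

Lemma dvdn_biggcd_mul (I : finType) (x : I -> nat) (n m : nat) :
  (forall i, n %| x i * m)%N -> (n %| \big[gcdn/0%N]_i x i * m)%N.
Proof.
move=> nx; elim/big_ind: _ => [|y z|i _]; rewrite ?mul0n ?dvdn0 //.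
by rewrite muln_gcdl dvdn_gcd => -> ->.
Qed.

Theorem theorem1p51 (f : {poly int}) (n : nat) (hfn : size f = n.+1)
  (ha : f`_0 * f`_n != 0)
  (k : nat) (hk : (2 <= k)%N)
  (p : 'I_k -> nat) (hp : forall i : 'I_k, prime (p i)) (hpinj : injective p)
  (j : 'I_k -> nat) (hj : forall i : 'I_k, (0 < j i < n)%N)
  (hcase : forall i : 'I_k, case_i f n (p i) (j i) \/ case_ii f n (p i) (j i))
  (hgcd : \big[gcdn/0%N]_(i < k) (n %/ dp f n (p i) (j i))%N = 1%N) :
  irreducible_poly (map_poly (intr : int -> rat) f).
Proof.
have /norP[f0 fn] : ~~ ((f`_0 == 0) || (f`_n == 0)) by rewrite -mulf_eq0.
have n0 : (0 < n)%N by have := hj (Ordinal (ltnW hk)); lia.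
have szQ (q : {poly int}) : size (map_poly (intr : int -> rat) q) = size q.
  by rewrite size_map_inj_poly //; apply: intr_inj.
(* Gauss: a rational divisor is a scalar multiple of an integral factor [g] of [f]. *)
split=> [|q q1 /[dup] dq /dvdpP_rat_int[g [a a0 Eq] [h Ef]]]; first by rewrite szQ hfn.
have szq : size q = size g by rewrite Eq size_scale ?szQ.
have dn i : (dp f n (p i) (j i) %| (size g).-1)%N.
  have [fj le1 le2 conv] : [/\ f`_(j i) != 0, _, _ & _] :=
    match hcase i with
    | or_introl H => case_iP (hj i) f0 fn H
    | or_intror H => case_iiP (hj i) f0 fn H
    end.
  by move: hfn f0 fj le1 le2 conv; rewrite Ef => szf *; apply: (dp_dvd_deg (hp i) szf (hj i)).
have ndeg : (n %| (size g).-1)%N.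
  rewrite -[X in (_ %| X)%N]mul1n -hgcd; apply: dvdn_biggcd_mul => i.
  have dpn : (dp f n (p i) (j i) %| n)%N by apply: dp_dvd; have := hj i; lia.
  by rewrite -{1}(divnK dpn) dvdn_mul.
have [g0 h0] : g != 0 /\ h != 0 by apply/andP; rewrite -negb_or -mulf_eq0 -Ef -size_poly_eq0 hfn.
have sg1 : (1 < size g)%N by rewrite ltn_neqAle eq_sym -szq q1 szq lt0n size_poly_eq0.
(* The divisor is not constant, so its degree is a positive multiple of [n], hence [n] itself, and
   it is associated to [f]. *)
have lenm : (n <= (size g).-1)%N by apply: dvdn_leq ndeg; lia.
rewrite -dvdp_size_eqp // szQ szq eqn_leq hfn.
have := size_mul g0 h0; rewrite -Ef hfn; move: h0 lenm; rewrite -size_poly_eq0.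
by move: (size g) (size h) => x y; lia.
Qed.
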